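(* There is a randomized algorithm which, given $\epsilon\in(0,1)$ and entry-query access to a symmetric PSD matrix $A\in\mathbb{R}^{n\times n}$ with $\max_{i,j}|A_{ij}|\le 1$, adaptively queries $\tilde O(1/\epsilon^3)$ entries of $A$ and with probability at least $2/3$ outputs an additive $\epsilon n$-approximation to the spectrum of $A$.
   Context: $\tilde O(f)$ means $O(f\log^{c} f)$ for some absolute constant $c$. A sequence $\hat\lambda_1\ge\dots\ge\hat\lambda_n$ is an additive $\alpha$-approximation to the spectrum of symmetric $A$ if $|\hat\lambda_i-\lambda_i(A)|\le\alpha$ for all $i$, where $\lambda_1(A)\ge\dots\ge\lambda_n(A)$ are the eigenvalues of $A$. *)

(* Defs.v *)
From HB Require Import structures.
From mathcomp Require Import all_boot all_order all_algebra.
From mathcomp Require Import boolp reals exp.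
Set Implicit Arguments. Unset Strict Implicit. Unset Printing Implicit Defensive.
Import Order.TTheory GRing.Theory Num.Theory.
Local Open Scope ring_scope.

Section Defs.
Variable R : realType.

Definition symmetric_mx n (A : 'M[R]_n) : Prop := A^T = A.
Definition psd n (A : 'M[R]_n) : Prop :=
  symmetric_mx A /\ forall x : 'cV[R]_n, 0 <= (x^T *m A *m x) 0 0.

Definition is_spectrum n (A : 'M[R]_n) (lam : seq R) : Prop :=
  [/\ size lam = n, sorted (fun x y => y <= x) lam &
      char_poly A = \prod_(x <- lam) ('X - x%:P)].

Definition spectrum_approx n (A : 'M[R]_n) (alpha : R) (lhat : seq R) : Prop :=
  [/\ size lhat = n, sorted (fun x y => y <= x) lhat &
      exists lam, is_spectrum A lam /\
        forall i : 'I_n, `|lhat`_i - lam`_i| <= alpha].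

(* Deterministic adaptive entry-query algorithm on n x n inputs
   (decision tree): query entry (i,j), continue depending on the answer,
   or output a sequence of reals. *)
Inductive qtree (n : nat) : Type :=
  | Ask of 'I_n & 'I_n & (R -> qtree n)
  | Ret of seq R.

Fixpoint qrun n (t : qtree n) (A : 'M[R]_n) : seq R :=
  match t with
  | Ask i j k => qrun (k (A i j)) A
  | Ret s => s
  end.

Fixpoint nqueries n (t : qtree n) (A : 'M[R]_n) : nat :=
  match t with
  | Ask i j k => (nqueries (k (A i j)) A).+1
  | Ret _ => 0%N
  end.

Record rand_qalg (n : nat) : Type := RandQAlg {
  seed : finType;
  weight : seed -> R;
  weight_ge0 : forall s, 0 <= weight s;
  weight_sum1 : \sum_(s : seed) weight s = 1;
  alg_of : seed -> qtree n }.

Definition success_prob n (B : rand_qalg n) (A : 'M[R]_n) (P : seq R -> Prop) : R :=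
  \sum_(s : seed B | `[< P (qrun (alg_of s) A) >]) weight s.

End Defs.

(* Main.v *)
Require Import Defs.
From HB Require Import structures.
From mathcomp Require Import all_boot all_order all_algebra.
From mathcomp Require Import spectral sesquilinear complex ring lra.
From mathcomp Require Import boolp reals exp.
Import Order.TTheory GRing.Theory Num.Theory.
Local Open Scope ring_scope.
Set Implicit Arguments. Unset Strict Implicit. Unset Printing Implicit Defensive.

(** A uniform sample of m = O(1/eps^2) indices suffices for the spectrum: writing
    A = B^2, the rescaled principal submatrix A_T is a Gram matrix of the sampled
    columns of B, and (1/m) sum_(t in T) b_t b_t^T is within eps of A/n in
    Frobenius norm, by a variance computation.

    The spectrum of A_T is then read off a Nystrom approximation with O~(1/eps)
    uniformly random pivots.  If E is the current residual and E' the residual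
    after pivoting at i, then tr E'^p <= tr E^p - (E^(p+1))_ii, by Jensen's
    inequality for the compression of E by a projection.  Averaging over i, the
    normalized moments f_p(t) of the residual after t pivots satisfy
    f_p(t+1) + f_(p+1)(t) <= f_p(t), whence f_(p+1)(pK) <= K^-p.  With p of
    order log(1/eps) and K of order 1/eps, Markov's inequality bounds the operator
    norm of the residual by eps m.  Only m p K entries of A_T are read. *)

(** * The spectral theorem for real symmetric matrices *)

Section Spectral.
Variable R : realType.

Lemma dot_ge0 n (v : 'rV[R]_n) : 0 <= (v *m v^T) 0 0.
Proof. by rewrite mxE; apply: sumr_ge0 => i _; rewrite mxE -expr2 sqr_ge0. Qed.

Lemma dot_eq0 n (v : 'rV[R]_n) : (v *m v^T) 0 0 = 0 -> v = 0.
Proof.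
rewrite mxE => v0; apply/rowP => i; rewrite mxE.
have ge0 (j : 'I_n) : true -> 0 <= v 0 j * v^T j 0 by rewrite mxE -expr2 sqr_ge0.
by have /eqP := psumr_eq0P ge0 v0 (i := i) isT; rewrite mxE mulf_eq0 orbb => /eqP.
Qed.

Lemma dot_gt0 n (v : 'rV[R]_n) : v != 0 -> 0 < (v *m v^T) 0 0.
Proof.
by move=> v0; rewrite lt_def dot_ge0 andbT; apply: contra v0 => /eqP/dot_eq0->.
Qed.

(** Over the complex numbers [A] is Hermitian, so it has an eigenvalue, and a real one. Being an
    eigenvalue survives the descent to the base field, which yields a real eigenvector to
    normalize. *)
Lemma real_eigenvector n (A : 'M[R]_n.+1) : A^T = A ->
  exists a (v : 'rV_n.+1), v *m A = a *: v /\ (v *m v^T) 0 0 = 1.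
Proof.
move=> symA; pose f := real_complex R; pose AC := map_mx f A.
have realAC : AC \is a mxOver Num.real.
  by apply/mxOverP => i j; rewrite mxE complex_real.
have symAC : AC \is symmetricmx.
  by apply/is_hermitianmxP; rewrite expr0 scale1r map_mx_id // /AC map_trmx symA.
have hAC := realsym_hermsym symAC realAC.
have /orthomx_spectralP eA := hermitian_normalmx hAC.
have /mxOverP/(_ 0 0)/complex_realP[a da] := hermitian_spectral_diag_real hAC.
have: eigenvalue AC (f a).
  set P := spectralmx AC in eA *; have uP : P \in unitmx by exact: spectral_unit.
  apply/eigenvalueP; exists (delta_mx 0 0 *m P).
    rewrite [in LHS]eA !mulmxA mulmxK //.
    rewrite -[delta_mx 0 0 *m diag_mx _]rowE row_diag_mx da.
    by rewrite scalemxAl.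
  apply/eqP => /(congr1 (mulmx^~ (invmx P))); rewrite mulmxK // mul0mx.
  by move/matrixP/(_ 0 0)/eqP; rewrite !mxE !eqxx oner_eq0.
rewrite eigenvalue_map => /eigenvalueP[v vA v0].
have vv := dot_gt0 v0.
exists a, ((Num.sqrt ((v *m v^T) 0 0))^-1 *: v); split.
  by rewrite -scalemxAl vA scalerA mulrC -scalerA.
rewrite linearZ /= -scalemxAl -scalemxAr scalerA mxE -expr2 exprVn sqr_sqrtr ?ltW //.
by rewrite mulVf // gt_eqF.
Qed.

Lemma dotC n (v w : 'rV[R]_n) : (v *m w^T) 0 0 = (w *m v^T) 0 0.
Proof. by rewrite -[v *m _]trmxK trmx_mul trmxK mxE. Qed.

Lemma row_sqr_mx n (v : 'rV[R]_n) : v *m v^T = ((v *m v^T) 0 0)%:M.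
Proof. exact: mx11_scalar. Qed.

(* The Householder reflection along [v - e_0]. *)
Lemma reflection_to n (v : 'rV[R]_n.+1) : (v *m v^T) 0 0 = 1 ->
  exists H : 'M_n.+1, [/\ H^T = H, H *m H = 1%:M & delta_mx 0 0 *m H = v].
Proof.
move=> v1; have [->|vn0] := eqVneq v (delta_mx 0 0).
  by exists 1%:M; rewrite trmx1 !mulmx1.
pose w := v - delta_mx 0 0; pose c := (w *m w^T) 0 0.
have c0 : c != 0 by rewrite gt_eqF // dot_gt0 // subr_eq0.
have e1 (u : 'rV_n.+1) : (u *m (delta_mx 0 0 : 'rV[R]_n.+1)^T) 0 0 = u 0 0.
  by rewrite trmx_delta -colE mxE.
have cE : c = 2 * (1 - v 0 0).
  rewrite /c {2}/w linearB /= mulmxBr mxE [X in _ + X]mxE e1.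
  rewrite /w mulmxBl mxE [X in _ + X - _]mxE (dotC (delta_mx 0 0) v) e1 v1 !mxE !eqxx.
  by rewrite mulr1n; ring.
have vE : delta_mx 0 0 + w = v by rewrite addrC subrK.
have cw : w *m w^T = c%:M by rewrite row_sqr_mx.
have we : (w *m (delta_mx 0 0 : 'rV[R]_n.+1)^T) 0 0 = v 0 0 - 1.
  by rewrite e1 !mxE eqxx.
clearbody c w; have MM : (w^T *m w) *m (w^T *m w) = c *: (w^T *m w).
  by rewrite mulmxA -(mulmxA _ w) cw mul_mx_scalar -scalemxAl.
have eM : delta_mx 0 0 *m (w^T *m w) = (v 0 0 - 1) *: w.
  rewrite mulmxA [_ *m w^T]mx11_scalar mul_scalar_mx; congr (_ *: _).
  by rewrite dotC.
exists (1%:M - (2 / c) *: (w^T *m w)); split.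
- by rewrite linearB linearZ /= trmx_mul trmxK trmx1.
- rewrite mulmxBl mul1mx mulmxBr mulmx1 -scalemxAl -scalemxAr MM !scalerA.
  have -> : 2 / c * (2 / c) * c = 2 / c + 2 / c by field.
  by rewrite scalerDl opprB addrK subrK.
- rewrite mulmxBr mulmx1 -scalemxAr eM scalerA.
  have -> : 2 / c * (v 0 0 - 1) = -1.
    by rewrite cE; field; move: c0; rewrite cE mulf_eq0 pnatr_eq0 /=.
  by rewrite scaleN1r opprK.
Qed.

(** Deflation: a reflection exchanging [e_0] with a unit eigenvector makes the first row and column
    vanish off the diagonal; induction treats the remaining block. *)
Lemma sym_spectral n (A : 'M[R]_n) : A^T = A ->
  exists (P : 'M_n) (d : 'rV_n), P *m P^T = 1%:M /\ A = P^T *m diag_mx d *m P.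
Proof.
elim: n A => [|n IHn] A symA.
  by exists 1%:M, 0; split; apply/matrixP => - [].
have [a [v [vA v1]]] := real_eigenvector symA.
have [H [symH HH eH]] := reflection_to v1.
have vH : v *m H = delta_mx 0 0 by rewrite -eH -mulmxA HH mulmx1.
have [A' A'def] : exists A' : 'M_(1 + n), A' = H *m A *m H by exists (H *m A *m H).
have symA' : A'^T = A' by rewrite A'def !trmx_mul symH symA mulmxA.
have row0A' : row 0 A' = a *: delta_mx 0 0.
  by rewrite rowE A'def !mulmxA eH vA -scalemxAl vH.
have A'0 j : A' 0 j = a *+ (j == 0).
  by move/rowP/(_ j): row0A'; rewrite !mxE eqxx /= mulr_natr.
pose A2 := drsubmx A'.
have symA2 : A2^T = A2 by rewrite /A2 trmx_drsub symA'.
have l0 (i : 'I_1) : lshift n i = 0 :> 'I_(1 + n) by apply: val_inj; rewrite ord1.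
have A'E : A' = block_mx a%:M 0 0 A2.
  rewrite -[LHS]submxK; congr block_mx; apply/matrixP => i j.
  - by rewrite 3!mxE !l0 A'0 !ord1.
  - by rewrite 3!mxE !l0 A'0 /= mulr0n.
  - by rewrite -symA' 4!mxE !l0 A'0 /= mulr0n.
have [P2 [d2 [P2P2 A2E]]] := IHn _ symA2.
pose Q : 'M_(1 + n) := block_mx 1%:M 0 0 P2.
have QQ : Q *m Q^T = 1%:M.
  rewrite /Q tr_block_mx !trmx0 trmx1 mulmx_block !mulmx0 !mul0mx !addr0 !add0r.
  by rewrite mul1mx P2P2 -scalar_mx_block.
have QdQ : Q^T *m diag_mx (row_mx (a%:M : 'M_1) d2) *m Q = A'.
  rewrite diag_mx_row /Q tr_block_mx !trmx0 trmx1.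
  rewrite !(mulmx_block, mulmx0, mul0mx, mulmx1, mul1mx, addr0, add0r).
  rewrite -A2E A'E; congr block_mx.
  by apply/matrixP => i j; rewrite !ord1 !mxE eqxx.
have AE : A = H *m A' *m H by rewrite A'def !mulmxA HH mul1mx -mulmxA HH mulmx1.
exists (Q *m H), (row_mx (a%:M : 'M_1) d2); split.
  by rewrite trmx_mul symH mulmxA -(mulmxA Q) HH mulmx1 QQ.
by rewrite trmx_mul symH AE -QdQ !mulmxA.
Qed.

End Spectral.

(** * Eigenvalue counting and Weyl's inequality *)

Section Eigen.
Variable R : realType.

(** The rows of [P] are an orthonormal eigenbasis. As [d] is in no particular order, spectra are
    compared by counting eigenvalues above a threshold. *)
Definition eigendec n (A P : 'M[R]_n) (d : 'rV_n) :=
  P *m P^T = 1%:M /\ A = P^T *m diag_mx d *m P.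

Lemma char_poly_eigendec n (A P : 'M[R]_n) d : eigendec A P d ->
  char_poly A = \prod_j ('X - (d 0 j)%:P).
Proof.
move=> [PP ->]; have PP' : P^T *m P = 1%:M by apply: mulmx1C.
transitivity (char_poly (diag_mx d)); last first.
  rewrite char_poly_trig ?diag_mx_is_trig //.
  by apply: eq_bigr => j _; rewrite mxE eqxx.
rewrite /char_poly /char_poly_mx !map_mxM.
have PPx : map_mx polyC P^T *m map_mx polyC P = 1%:M by rewrite -map_mxM PP' map_mx1.
rewrite -[in LHS](mulmx1 'X%:M) -PPx mulmxA -scalar_mxC -mulmxBl -mulmxBr.
by rewrite !det_mulmx mulrAC -det_mulmx PPx det1 mul1r.
Qed.

Lemma eigendec_qform n (A P : 'M[R]_n) d (x : 'rV_n) : eigendec A P d ->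
  (x *m A *m x^T) 0 0 = \sum_j d 0 j * (x *m P^T) 0 j ^+ 2.
Proof.
move=> [_ ->]; have e : P *m x^T = (x *m P^T)^T by rewrite trmx_mul trmxK.
rewrite !mulmxA -(mulmxA _ P x^T) e; move: (x *m P^T) => y.
rewrite mxE; apply: eq_bigr => j _.
by rewrite mul_mx_diag !mxE expr2 mulrAC mulrC.
Qed.

Lemma eigendec_dot n (A P : 'M[R]_n) d (x : 'rV_n) : eigendec A P d ->
  (x *m x^T) 0 0 = \sum_j (x *m P^T) 0 j ^+ 2.
Proof.
move=> [PP _]; have PP' : P^T *m P = 1%:M by apply: mulmx1C.
have e : P *m x^T = (x *m P^T)^T by rewrite trmx_mul trmxK.
rewrite -{1}(mulmx1 x) -PP' mulmxA -mulmxA e; move: (x *m P^T) => y.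
by rewrite mxE; apply: eq_bigr => j _; rewrite mxE expr2.
Qed.

Lemma eigendec_exp n (A P : 'M[R]_n) d p : eigendec A P d ->
  eigendec (A ^+ p) P (map_mx (fun x => x ^+ p) d).
Proof.
move=> [PP AE]; split=> //; have PP' : P^T *m P = 1%:M by apply: mulmx1C.
elim: p => [|p IHp].
  rewrite expr0 (_ : diag_mx _ = 1%:M) ?mulmx1 ?PP' //.
  by apply/matrixP => i j; rewrite !mxE expr0.
have -> : A ^+ p.+1 = A *m (A ^+ p) by exact: exprS.
rewrite IHp {1}AE !mulmxA -(mulmxA _ P) PP mulmx1.
congr (_ *m _); rewrite -mulmxA; congr (_ *m _); rewrite mulmx_diag.
by congr diag_mx; apply/rowP => j; rewrite !mxE exprS.
Qed.

Lemma eigendec_trace n (A P : 'M[R]_n) d : eigendec A P d ->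
  \tr A = \sum_j d 0 j.
Proof.
move=> [PP ->]; rewrite mxtrace_mulC mulmxA PP mul1mx mxtrace_diag //.
Qed.

Lemma eigendec_eigenvector n (A P : 'M[R]_n) d j : eigendec A P d ->
  (row j P *m A *m (row j P)^T) 0 0 = d 0 j.
Proof.
move=> dA; have [PP _] := dA; rewrite (eigendec_qform _ dA) (bigD1 j) //=.
rewrite big1 => [|i ij]; rewrite -row_mul PP !mxE ?eqxx ?expr1n ?mulr1 ?addr0 //.
by rewrite eq_sym (negPf ij) expr0n mulr0.
Qed.

Lemma eigendecZ n (A P : 'M[R]_n) d k : eigendec A P d ->
  eigendec (k *: A) P (k *: d).
Proof.
move=> [PP ->]; split=> //; rewrite linearZ /=.
by rewrite -scalemxAr -scalemxAl.
Qed.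

(** Dimension count: the rows of [P] in [a] span dimension [#|a|], and [b] imposes only [#|b|]
    linear conditions. Through [L] these may live in another dimension: it is the identity for
    Weyl's inequality, and a sampling matrix or its transpose afterwards. *)
Lemma vanishing_combination m n (P : 'M[R]_m) (P' : 'M[R]_n) (L : 'M_(m, n))
    (a : pred 'I_m) (b : pred 'I_n) :
  P *m P^T = 1%:M -> (#|b| < #|a|)%N ->
  exists y : 'rV_m, [/\ y != 0, forall i, ~~ a i -> (y *m P^T) 0 i = 0 &
    forall j, b j -> (y *m L *m P'^T) 0 j = 0].
Proof.
move=> PP ba; pose f (i : 'I_#|a|) : 'I_m := enum_val i.
pose g (i : 'I_#|b|) : 'I_n := enum_val i.
pose S := rowsub f P; pose N := colsub g (S *m L *m P'^T).
have /rowV0Pn[u /sub_kermxP uN u0] : kermx N != 0.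
  rewrite -mxrank_eq0 mxrank_ker -lt0n subn_gt0.
  exact: leq_ltn_trans (rank_leq_col _) ba.
have SP : S *m P^T = rowsub f 1%:M by rewrite mul_rowsub_mx PP.
have uSP i : (u *m S *m P^T) 0 i = \sum_k u 0 k * (f k == i)%:R.
  by rewrite -mulmxA SP mxE; apply: eq_bigr => k _; rewrite !mxE.
exists (u *m S); split.
- apply: contra u0 => /eqP uS0; apply/eqP/rowP => k.
  have := uSP (f k); rewrite uS0 mul0mx (bigD1 k) //= eqxx mulr1.
  rewrite big1 ?addr0 => [|k' kk']; first by rewrite !mxE => <-.
  by rewrite (inj_eq enum_val_inj) (negPf kk') mulr0.
- move=> i ai; rewrite uSP big1 // => k _.
  have /negPf -> : f k != i; last by rewrite mulr0.
  by apply: contra ai => /eqP <-; exact: (enum_valP k).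
- move=> j bj; pose k := enum_rank_in bj j.
  have gk : g k = j by rewrite /g enum_rankK_in.
  rewrite -!mulmxA !(mulmxA S) -gk; move: uN; rewrite /N; move: (S *m L *m P'^T) => M.
  move/rowP/(_ k); rewrite [in X in _ = X]mxE => <-; rewrite [LHS]mxE [RHS]mxE.
  by apply: eq_bigr => i _; rewrite [colsub _ _ _ _]mxE.
Qed.

Lemma eig_support_gt n (A P : 'M[R]_n) d (y : 'rV_n) t : eigendec A P d -> y != 0 ->
  (forall i, ~~ (t < d 0 i) -> (y *m P^T) 0 i = 0) ->
  t * (y *m y^T) 0 0 < (y *m A *m y^T) 0 0.
Proof.
move=> dA y0 ya; have := dot_gt0 y0.
rewrite (eigendec_dot _ dA) (eigendec_qform _ dA) mulr_sumr.
set z := y *m P^T in ya *; clearbody z => z0; rewrite -subr_gt0 -sumrB lt_def.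
have ge0 j : 0 <= d 0 j * z 0 j ^+ 2 - t * z 0 j ^+ 2.
  rewrite -mulrBl; case: (ltP t (d 0 j)) => [tj|jt].
    by rewrite mulr_ge0 ?sqr_ge0 // subr_ge0 ltW.
  by rewrite ya -?leNgt // expr0n mulr0.
(* Equality would make every term [(d_j - t) z_j^2] vanish, hence [z = 0]. *)
rewrite sumr_ge0 // andbT; apply/eqP => /psumr_eq0P s0.
move: z0; rewrite big1 ?ltxx // => j _.
case: (ltP t (d 0 j)) => [tj|jt]; last by rewrite ya -?leNgt // expr0n.
have /eqP := s0 (fun j _ => ge0 j) j isT.
by rewrite -mulrBl mulf_eq0 subr_eq0 gt_eqF //= => /eqP.
Qed.

Lemma eig_support_le n (A P : 'M[R]_n) d (y : 'rV_n) t : eigendec A P d ->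
  (forall i, t < d 0 i -> (y *m P^T) 0 i = 0) ->
  (y *m A *m y^T) 0 0 <= t * (y *m y^T) 0 0.
Proof.
move=> dA ya; rewrite (eigendec_dot _ dA) (eigendec_qform _ dA) mulr_sumr.
apply: ler_sum => j _; case: (ltP t (d 0 j)) => [tj|jt].
  by rewrite ya // expr0n /= !mulr0.
by rewrite ler_wpM2r ?sqr_ge0.
Qed.

(** Otherwise some nonzero [y] lies in the eigenspaces of [A'] above [t + e] and is orthogonal to
    those of [A] above [t]; its two Rayleigh quotients contradict the comparison of forms. *)
Lemma weyl_count n (A P A' P' : 'M[R]_n) d d' (e t : R) :
  eigendec A P d -> eigendec A' P' d' ->
  (forall x : 'rV_n, (x *m A' *m x^T) 0 0 <= (x *m A *m x^T) 0 0 + e * (x *m x^T) 0 0) ->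
  (#|[pred j | (t + e < d' 0 j)%R]| <= #|[pred j | (t < d 0 j)%R]|)%N.
Proof.
move=> dA dA' le_q; rewrite leqNgt; apply/negP => ltc.
have [y [y0 ya yb]] := vanishing_combination P 1%:M dA'.1 ltc.
have h1 := eig_support_gt dA' y0 ya.
have := eig_support_le dA yb; rewrite mulmx1 => h2.
have := le_q y; lra.
Qed.

Lemma cauchy_schwarz n (x y : 'rV[R]_n) :
  (x *m y^T) 0 0 ^+ 2 <= (x *m x^T) 0 0 * (y *m y^T) 0 0.
Proof.
have [->|y0] := eqVneq y 0; first by rewrite trmx0 !mulmx0 mxE expr0n mulr0.
have yy := dot_gt0 y0; set a := (x *m x^T) 0 0; set b := (y *m y^T) 0 0 in yy *.
set c := (x *m y^T) 0 0.
have dE (u v : 'rV[R]_n) : (u *m v^T) 0 0 = \sum_i u 0 i * v 0 i.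
  by rewrite mxE; apply: eq_bigr => i _; rewrite mxE.
(* The vector [b x - c y] is [b] times the component of [x] orthogonal to [y]. *)
have : 0 <= \sum_i (b * x 0 i - c * y 0 i) ^+ 2 by apply: sumr_ge0 => i _; rewrite sqr_ge0.
have -> : \sum_i (b * x 0 i - c * y 0 i) ^+ 2 = b ^+ 2 * a - 2 * b * c * c + c ^+ 2 * b.
  rewrite {3}/c {4}/b /a !dE !mulr_sumr -sumrB -big_split /=.
  by apply: eq_bigr => i _; ring.
have -> : b ^+ 2 * a - 2 * b * c * c + c ^+ 2 * b = b * (a * b - c ^+ 2) by ring.
by rewrite pmulr_rge0 // subr_ge0.
Qed.

(** The forms compare [A] with [C C^T], the counts with [C^T C]. For [Y = |y|^2] and [Z = |y C|^2]
    the choice of [y] gives [Z > t Y], whereas [|y C C^T|^2 <= t Z] and Cauchy-Schwarz give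
    [Z^2 <= t Y Z]. *)
Lemma sample_count_le m n (C : 'M[R]_(n, m)) (A P : 'M[R]_n) (A' P' : 'M[R]_m)
    d d' (e t : R) : 0 <= t ->
  eigendec A P d -> eigendec A' P' d' -> A' = C^T *m C ->
  (forall x : 'rV_n, (x *m A *m x^T) 0 0 <=
     (x *m (C *m C^T) *m x^T) 0 0 + e * (x *m x^T) 0 0) ->
  (#|[pred j | (t + e < d 0 j)%R]| <= #|[pred j | (t < d' 0 j)%R]|)%N.
Proof.
move=> t0 dA dA' A'E le_q; rewrite leqNgt; apply/negP => ltc.
have [y [y0 ya yb]] := vanishing_combination P' C dA.1 ltc.
have yy := dot_gt0 y0; have h1 := eig_support_gt dA y0 ya.
have h2 := eig_support_le dA' yb; have h3 := le_q y.
have h4 := cauchy_schwarz y (y *m C *m C^T).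
have zE : (y *m C *m (y *m C)^T) 0 0 = (y *m (y *m C *m C^T)^T) 0 0.
  by rewrite !trmx_mul trmxK !mulmxA.
have qE : (y *m (C *m C^T) *m y^T) 0 0 = (y *m C *m (y *m C)^T) 0 0.
  by rewrite trmx_mul !mulmxA.
have aE : (y *m C *m A' *m (y *m C)^T) 0 0 = (y *m C *m C^T *m (y *m C *m C^T)^T) 0 0.
  by rewrite A'E !trmx_mul !trmxK !mulmxA.
rewrite -zE in h4; rewrite aE in h2; rewrite qE in h3.
set Z := (y *m C *m (y *m C)^T) 0 0 in h2 h3 h4.
set Y := (y *m y^T) 0 0 in yy h1 h3 h4.
have tZ : t * Y < Z by lra.
have Z0 : 0 < Z by apply: le_lt_trans tZ; rewrite mulr_ge0 // ltW.
have : Z ^+ 2 <= Y * (t * Z) by apply: le_trans h4 _; apply: (ler_wpM2l (ltW yy)).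
by rewrite expr2 mulrA ler_pM2r // leNgt mulrC tZ.
Qed.

(** Here [y] lives on the sample side and [y C^T] tests [A]. With [X = |y C^T|^2], Cauchy-Schwarz
    for [y] and [y A'] gives [X^2 <= (t + e) Y X], against [X > (t + e) Y]. *)
Lemma sample_count_ge m n (C : 'M[R]_(n, m)) (A P : 'M[R]_n) (A' P' : 'M[R]_m)
    d d' (e t : R) : 0 <= t -> 0 <= e ->
  eigendec A P d -> eigendec A' P' d' -> A' = C^T *m C ->
  (forall x : 'rV_n, (x *m (C *m C^T) *m x^T) 0 0 <=
     (x *m A *m x^T) 0 0 + e * (x *m x^T) 0 0) ->
  (#|[pred j | (t + e < d' 0 j)%R]| <= #|[pred j | (t < d 0 j)%R]|)%N.
Proof.
move=> t0 e0 dA dA' A'E le_q; rewrite leqNgt; apply/negP => ltc.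
have [y [y0 ya yb]] := vanishing_combination P C^T dA'.1 ltc.
have yy := dot_gt0 y0; have h1 := eig_support_gt dA' y0 ya.
have h2 := eig_support_le dA yb; have h3 := le_q (y *m C^T).
have h4 := cauchy_schwarz y (y *m A').
have xE : (y *m C^T *m (y *m C^T)^T) 0 0 = (y *m A' *m y^T) 0 0.
  by rewrite trmx_mul trmxK A'E !mulmxA.
have symA' : A'^T = A' by rewrite A'E trmx_mul trmxK.
have yE : (y *m (y *m A')^T) 0 0 = (y *m A' *m y^T) 0 0.
  by rewrite trmx_mul symA' mulmxA.
have qE : (y *m C^T *m (C *m C^T) *m (y *m C^T)^T) 0 0 = (y *m A' *m (y *m A')^T) 0 0.
  by rewrite !trmx_mul symA' trmxK A'E !mulmxA.
rewrite xE in h2 h3; rewrite yE in h4; rewrite qE in h3.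
set X := (y *m A' *m y^T) 0 0 in h1 h2 h3 h4.
set Y := (y *m y^T) 0 0 in yy h1 h4; set W := (y *m A' *m _) 0 0 in h3 h4.
have X0 : 0 < X by apply: le_lt_trans h1; rewrite mulr_ge0 ?addr_ge0 // ltW.
have : X ^+ 2 <= Y * ((t + e) * X).
  by apply: le_trans h4 _; apply: (ler_wpM2l (ltW yy)); lra.
by rewrite expr2 mulrA ler_pM2r // leNgt mulrC h1.
Qed.

End Eigen.

(** * Pivoting and traces of powers *)

Section Pivot.
Variable R : realType.

Lemma psd_row n (A : 'M[R]_n) (x : 'rV_n) : psd A -> 0 <= (x *m A *m x^T) 0 0.
Proof. by move=> [_ /(_ x^T)]; rewrite trmxK. Qed.

Lemma gram_psd m n (B : 'M[R]_(n, m)) : psd (B *m B^T).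
Proof.
split=> [|x]; first by rewrite /symmetric_mx trmx_mul trmxK.
rewrite -[X in _ *m X]trmxK (_ : _ *m _ *m _ = (x^T *m B) *m (x^T *m B)^T).
  exact: dot_ge0.
by rewrite trmx_mul !trmxK !mulmxA.
Qed.

Lemma psd_eigendec n (A : 'M[R]_n) : psd A ->
  exists P d, eigendec A P d /\ forall j, 0 <= d 0 j.
Proof.
move=> pA; have [P [d dA]] := sym_spectral pA.1; exists P, d; split=> // j.
by rewrite -(eigendec_eigenvector j dA) psd_row.
Qed.

Lemma psd_sqrt n (A : 'M[R]_n) : psd A -> exists B, B^T = B /\ A = B *m B.
Proof.
move=> /psd_eigendec[P [d [[PP ->] d0]]].
exists (P^T *m diag_mx (map_mx Num.sqrt d) *m P); split.
  by rewrite !trmx_mul trmxK tr_diag_mx mulmxA.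
rewrite !mulmxA -(mulmxA _ P) PP mulmx1; congr (_ *m _).
rewrite -mulmxA mulmx_diag; congr (_ *m diag_mx _); apply/rowP => j.
by rewrite !mxE -expr2 sqr_sqrtr.
Qed.

Lemma psd_exp n (A : 'M[R]_n) p : psd A -> psd (A ^+ p).
Proof.
move=> /psd_eigendec[P [d [/(eigendec_exp p) dA d0]]].
have [_ AE] := dA; split=> [|x].
  by rewrite /symmetric_mx AE !trmx_mul trmxK tr_diag_mx mulmxA.
rewrite -[X in _ *m X]trmxK (eigendec_qform _ dA) sumr_ge0 // => j _.
by rewrite mxE mulr_ge0 ?sqr_ge0 ?exprn_ge0.
Qed.

Lemma psd_diag_ge0 n (A : 'M[R]_n) i : psd A -> 0 <= A i i.
Proof.
move=> pA; have := psd_row (delta_mx 0 i) pA.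
by rewrite trmx_delta -rowE -colE !mxE.
Qed.

Lemma psd_trace_ge0 n (A : 'M[R]_n) : psd A -> 0 <= \tr A.
Proof. by move=> pA; apply: sumr_ge0 => i _; apply: psd_diag_ge0. Qed.

(** Convexity of the power as a tangent bound. The induction adds [a] times the hypothesis to
    [(x^(p+1) - a^(p+1)) (x - a) >= 0]. *)
Lemma expr_tangent_le (x a : R) p : 0 <= x -> 0 <= a ->
  a ^+ p.+1 + p.+1%:R * a ^+ p * (x - a) <= x ^+ p.+1.
Proof.
move=> x0 a0; elim: p => [|p IHp]; first by rewrite expr0 !expr1; lra.
have h : 0 <= (x ^+ p.+1 - a ^+ p.+1) * (x - a).
  case: (leP a x) => ax.
    by rewrite mulr_ge0 // subr_ge0 // lerXn2r.
  by rewrite mulr_le0 // subr_le0 ?lerXn2r // ltW.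
have := ler_wpM2l a0 IHp; move: h; rewrite (exprS x p.+1) (exprS a p.+1) -(natr1 p.+1).
by rewrite !(exprS a p); move: (x ^+ p.+1) (a ^+ p) p.+1%:R => X q k; lra.
Qed.

(** Averages the tangent bound at the weighted sum [a]. With weights of total [s] this yields
    [a^(p+1) (1 + p (1 - s))], so a mass below one does no harm. *)
Lemma power_jensen (I : finType) (c l : I -> R) p :
  (forall i, 0 <= c i) -> (forall i, 0 <= l i) -> \sum_i c i <= 1 ->
  (\sum_i l i * c i) ^+ p.+1 <= \sum_i l i ^+ p.+1 * c i.
Proof.
move=> c0 l0 c1; set a := \sum_i l i * c i.
have a0 : 0 <= a by apply: sumr_ge0 => i _; rewrite mulr_ge0.
apply: (@le_trans _ _ (\sum_i (a ^+ p.+1 + p.+1%:R * a ^+ p * (l i - a)) * c i)).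
  have -> : \sum_i (a ^+ p.+1 + p.+1%:R * a ^+ p * (l i - a)) * c i =
    a ^+ p.+1 * \sum_i c i + p.+1%:R * a ^+ p * (a - a * \sum_i c i).
    rewrite {6}/a !mulr_sumr -sumrB mulr_sumr -big_split /=.
    by apply: eq_bigr => i _; ring.
  have := exprn_ge0 p a0 => ap; rewrite exprS.
  have := ler0n R p => p0; rewrite -natr1; set s := \sum_i c i in c1 *.
  have := mulr_ge0 (mulr_ge0 p0 (mulr_ge0 a0 ap)) (_ : 0 <= 1 - s).
  rewrite subr_ge0 => /(_ c1); nra.
by apply: ler_sum => i _; rewrite ler_wpM2r // expr_tangent_le.
Qed.

(** Jensen for the spectral measure of [E] at [w], of total mass [|w|^2]. *)
Lemma qform_jensen n (E : 'M[R]_n) (w : 'rV_n) p : psd E -> (w *m w^T) 0 0 <= 1 ->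
  ((w *m E *m w^T) 0 0) ^+ p.+1 <= (w *m E ^+ p.+1 *m w^T) 0 0.
Proof.
move=> /psd_eigendec[P [d [dE d0]]]; rewrite (eigendec_dot _ dE) (eigendec_qform _ dE).
rewrite (eigendec_qform _ (eigendec_exp p.+1 dE)) => w1.
under [leRHS]eq_bigr do rewrite mxE.
by apply: power_jensen => // i; rewrite sqr_ge0.
Qed.

Lemma expr_mulmx m n (X : 'M[R]_(m, n)) (Y : 'M_(n, m)) k :
  (X *m Y) ^+ k.+1 = X *m (Y *m X) ^+ k *m Y.
Proof.
elim: k => [|k IHk]; first by rewrite expr1 expr0 mulmx1.
rewrite exprS IHk; transitivity (X *m Y *m (X *m (Y *m X) ^+ k *m Y)); first by [].
rewrite !mulmxA; congr (_ *m _); rewrite -!mulmxA; congr (_ *m _).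
by rewrite exprS mulmxA.
Qed.

Lemma trace_expr_mulC m n (X : 'M[R]_(m, n)) (Y : 'M_(n, m)) k :
  \tr ((X *m Y) ^+ k.+1) = \tr ((Y *m X) ^+ k.+1).
Proof. by rewrite expr_mulmx mxtrace_mulC mulmxA exprS. Qed.

(** A Schur complement step. As [0^-1 = 0], a zero pivot subtracts nothing. *)
Definition pivot n (E : 'M[R]_n) (i : 'I_n) :=
  E - (E i i)^-1 *: (col i E *m (col i E)^T).

(** Pivoting is a compression: [Q] projects orthogonally to [u = B e_i], whose squared length is the
    pivot [s]. For [s = 0] it is the identity. *)
Lemma pivot_sqrt n (B : 'M[R]_n) i : B^T = B ->
  let E := B *m B in let s := E i i in let u := col i B in
  let Q := 1%:M - s^-1 *: (u *m u^T) in
  [/\ pivot E i = B *m Q *m B, Q^T = Q, Q *m Q = Q, u^T *m u = s%:M &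
      forall r : 'rV_n, (r *m Q *m (r *m Q)^T) 0 0 <= (r *m r^T) 0 0].
Proof.
move=> symB E s u Q.
have us : u^T *m u = s%:M.
  rewrite [LHS]mx11_scalar; congr _%:M.
  transitivity ((B^T *m B) i i); last by rewrite symB.
  by rewrite !mxE; apply: eq_bigr => k _; rewrite !mxE.
have s0 : 0 <= s.
  by have := dot_ge0 u^T; rewrite trmxK us mxE eqxx.
have QT : Q^T = Q by rewrite /Q linearB linearZ /= trmx_mul trmxK trmx1.
have colE' : col i E = B *m u by rewrite /E /u !colE mulmxA.
have QQ : Q *m Q = Q.
  rewrite /Q; set M := u *m u^T.
  have MM : M *m M = s *: M by rewrite /M mulmxA -(mulmxA u) us mul_mx_scalar -scalemxAl.
  rewrite mulmxBr mulmx1 mulmxBl mul1mx -!scalemxAl -!scalemxAr MM !scalerA.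
  have [->|s1] := eqVneq s 0; first by rewrite invr0 !mul0r !scale0r !subr0.
  by rewrite mulfVK // subrr subr0.
split=> //.
  rewrite /pivot colE' trmx_mul symB /Q mulmxBr mulmx1 mulmxBl -/s.
  by rewrite -scalemxAr -scalemxAl !mulmxA.
move=> r.
have -> : r *m Q *m (r *m Q)^T = r *m r^T - s^-1 *: ((r *m u) *m (r *m u)^T).
  rewrite !trmx_mul QT !mulmxA -(mulmxA r) QQ /Q mulmxBr mulmx1 mulmxBl.
  by rewrite -scalemxAr -scalemxAl !mulmxA.
move: (dot_ge0 (r *m u)); move: (_ *m _) (r *m r^T) => M N M0.
by rewrite !mxE gerBl mulr_ge0 ?invr_ge0.
Qed.

Lemma pivot_psd n (E : 'M[R]_n) i : psd E -> psd (pivot E i).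
Proof.
move=> /psd_sqrt[B [symB ->]]; have [-> QT QQ _ _] := pivot_sqrt i symB.
set Q := (1%:M - _) in QT QQ *.
rewrite (_ : _ *m _ *m _ = (B *m Q) *m (B *m Q)^T); first exact: gram_psd.
by rewrite trmx_mul QT symB !mulmxA -(mulmxA B Q Q) QQ.
Qed.

Lemma pivot_diag_le n (E : 'M[R]_n) i j : psd E -> pivot E i j j <= E j j.
Proof.
move=> pE; rewrite /pivot !mxE gerBl mulr_ge0 ?invr_ge0 ?psd_diag_ge0 //.
by rewrite big_ord1 !mxE -expr2 sqr_ge0.
Qed.

(** By cyclicity of the trace [B Q B] may be replaced by [Q E Q]. Jensen at each of its eigenvectors
    bounds the trace by [tr (Q E^(p+1) Q)], which is [tr E^(p+1) - s^-1 (E^(p+2))_ii]; finally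
    [s <= 1]. *)
Lemma pivot_trace n (E : 'M[R]_n) i p : psd E -> E i i <= 1 ->
  \tr (pivot E i ^+ p.+1) <= \tr (E ^+ p.+1) - (E ^+ p.+2) i i.
Proof.
move=> pE; case: (psd_sqrt pE) => B [symB EE].
have [] := pivot_sqrt i symB; rewrite -EE; set s := E i i; set u := col i B.
set Q := (1%:M - _) => pivE QT QQ us Qr s1.
have -> : \tr (pivot E i ^+ p.+1) = \tr ((Q *m E *m Q) ^+ p.+1).
  have -> : pivot E i = (B *m Q) *m (Q *m B) by rewrite pivE mulmxA -(mulmxA B Q Q) QQ.
  by rewrite trace_expr_mulC EE !mulmxA.
have symM : (Q *m E *m Q)^T = Q *m E *m Q by rewrite !trmx_mul QT pE.1 mulmxA.
have [V [d dM]] := sym_spectral symM; rewrite (eigendec_trace (eigendec_exp p.+1 dM)).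
have VV : V^T *m V = 1%:M by apply: mulmx1C; exact: dM.1.
apply: (@le_trans _ _ (\tr (Q *m E ^+ p.+1 *m Q))).
  have -> : \tr (Q *m E ^+ p.+1 *m Q) = \tr (V *m (Q *m E ^+ p.+1 *m Q) *m V^T).
    by rewrite [RHS]mxtrace_mulC [in RHS]mulmxA VV mul1mx.
  apply: ler_sum => j _; rewrite [leLHS]mxE -(eigendec_eigenvector j dM).
  (* The eigenvalue of [Q E Q] at its eigenvector [row j V] is the quadratic form of [E] at [w]. *)
  pose w := row j V *m Q.
  have w1 : (w *m w^T) 0 0 <= 1.
    apply: le_trans (Qr _) _.
    have -> : 1 = (V *m V^T) j j by rewrite dM.1 mxE eqxx.
    rewrite le_eqVlt; apply/orP; left; apply/eqP.
    rewrite [LHS]mxE [RHS]mxE; apply: eq_bigr => k _.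
  by rewrite !mxE.
  have := qform_jensen p pE w1; rewrite /w trmx_mul QT !mulmxA => le1.
  apply: le_trans le1 _.
  rewrite -!(mulmxA (row j V)) -row_mul [leRHS]mxE [leLHS]mxE !mulmxA.
  by rewrite [leLHS]mxE; apply: ler_sum => k _; rewrite !mxE.
rewrite mxtrace_mulC mulmxA QQ /Q mulmxBl mul1mx linearB /= lerD2l lerN2.
rewrite -scalemxAl linearZ /= -mulmxA mxtrace_mulC.
have trE : \tr (u^T *m E ^+ p.+1 *m u) = (E ^+ p.+2) i i.
  rewrite /mxtrace big_ord1 [in RHS]EE expr_mulmx -EE /u tr_col symB.
  rewrite -row_mul [LHS]mxE [RHS]mxE; apply: eq_bigr => k _.
  by rewrite !mxE.
(* For [s = 0] the column [u] vanishes, hence so does [(E^(p+2))_ii]; otherwise [s^-1 >= 1]. *)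
rewrite trE; have := psd_diag_ge0 i pE; rewrite -/s le_eqVlt => /predU1P[s0|s0].
  rewrite -trE (_ : u = 0) ?mulmx0 ?mxtrace0 ?mulr0 //.
  apply: trmx_inj; rewrite trmx0; apply: dot_eq0.
  by rewrite trmxK us mxE eqxx -s0.
rewrite ler_peMl ?invf_ge1 //; apply: psd_diag_ge0; exact: psd_exp.
Qed.
End Pivot.

(** * Averages over uniform samples *)

Section Mean.
Variables (R : realType) (T : finType).
Hypothesis T_gt0 : (0 < #|T|)%N.
Implicit Types (F G : seq T -> R).

(** Expectation over [k] independent uniform draws. Taking [F] on plain sequences lets [meanS] split
    off the first draw without casts. *)
Definition mean k F : R := (\sum_(s : k.-tuple T) F s) / (#|T| ^ k)%:R.

Let T0 : #|T|%:R != 0 :> R. Proof. by rewrite pnatr_eq0 -lt0n. Qed.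

Lemma mean0 F : mean 0 F = F [::].
Proof.
rewrite /mean expn0 divr1 (big_pred1 [tuple]) // => s.
by apply/esym/eqP; rewrite tuple0.
Qed.

Lemma meanS k F : mean k.+1 F = (\sum_x mean k (fun s => F (x :: s))) / #|T|%:R.
Proof.
rewrite /mean -mulr_suml expnSr natrM invfM mulrA; congr (_ / _ / _).
rewrite pair_bigA /= (reindex (fun q : T * k.-tuple T => cons_tuple q.1 q.2)) //=.
exists (fun s : k.+1.-tuple T => (thead s, behead_tuple s)) => [[x s] _|s _] /=.
  by congr pair; apply: val_inj.
by apply: val_inj; rewrite /= [s in RHS]tuple_eta.
Qed.

Lemma eq_mean k F G : (forall s, size s = k -> F s = G s) -> mean k F = mean k G.
Proof. by move=> FG; congr (_ / _); apply: eq_bigr => s _; rewrite FG ?size_tuple. Qed.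

Lemma ler_mean k F G : (forall s, F s <= G s) -> mean k F <= mean k G.
Proof. by move=> FG; rewrite ler_wpM2r ?invr_ge0 ?ler0n //; apply: ler_sum. Qed.

Lemma mean_ge0 k F : (forall s, 0 <= F s) -> 0 <= mean k F.
Proof. by move=> F0; rewrite mulr_ge0 ?invr_ge0 ?ler0n ?sumr_ge0. Qed.

Lemma meanZ k a F : mean k (fun s => a * F s) = a * mean k F.
Proof. by rewrite /mean -mulr_sumr mulrA. Qed.

Lemma mean_sum k (I : finType) (F : I -> seq T -> R) :
  mean k (fun s => \sum_i F i s) = \sum_i mean k (F i).
Proof. by rewrite /mean exchange_big /= mulr_suml. Qed.

(** Cross terms vanish because [g] is centred. The shift [c] carries the earlier draws through the
    induction. *)
Lemma mean_sqr_sum k (g : T -> R) c : \sum_x g x = 0 ->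
  mean k (fun s => (c + \sum_(x <- s) g x) ^+ 2) =
  c ^+ 2 + k%:R * ((\sum_x g x ^+ 2) / #|T|%:R).
Proof.
move=> g0; elim: k c => [|k IHk] c; first by rewrite mean0 big_nil addr0 mul0r addr0.
set V := _ / #|T|%:R.
rewrite meanS (eq_bigr (fun x => c ^+ 2 + 2 * c * g x + g x ^+ 2 + k%:R * V)) => [|x _].
  rewrite !big_split /= !sumr_const.
  rewrite -mulr_sumr g0 mulr0 addr0 -(mulr_natr (k%:R * V)) -(mulr_natr (c ^+ 2)) -natr1.
  by rewrite /V; field; exact: T0.
have -> : c ^+ 2 + 2 * c * g x + g x ^+ 2 = (c + g x) ^+ 2 by ring.
rewrite -IHk; apply: eq_mean => s _.
by rewrite big_cons addrA.
Qed.

Lemma mean_variance k (f : T -> R) : (0 < k)%N ->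
  mean k (fun s => ((\sum_(x <- s) f x) / k%:R - (\sum_x f x) / #|T|%:R) ^+ 2) <=
  (\sum_x f x ^+ 2) / #|T|%:R / k%:R.
Proof.
move=> k0; set mu := (\sum_x f x) / _; pose g x := f x - mu.
have kn0 : k%:R != 0 :> R by rewrite pnatr_eq0 -lt0n.
have g0 : \sum_x g x = 0 by rewrite sumrB sumr_const -(mulr_natr mu) /mu mulfVK ?subrr.
(* As [s] has length [k], the error of the sample mean is [1/k] times a sum of centred values. *)
rewrite (eq_mean (G := fun s => k%:R ^- 2 * (0 + \sum_(x <- s) g x) ^+ 2)); last first.
  move=> s sk; rewrite add0r sumrB big_const_seq count_predT sk iter_addr_0.
  by rewrite -(mulr_natr mu); field.
rewrite meanZ mean_sqr_sum // expr0n add0r mulrA -[k%:R ^- 2 * k%:R]/(_ * _).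
have -> : k%:R ^- 2 * k%:R = k%:R^-1 :> R by field.
rewrite mulrC ler_wpM2r ?invr_ge0 ?ler0n // ler_wpM2r ?invr_ge0 ?ler0n //.
have -> : \sum_x g x ^+ 2 = \sum_x f x ^+ 2 - #|T|%:R * mu ^+ 2.
  transitivity (\sum_x (f x ^+ 2 - 2 * mu * f x + mu ^+ 2)).
    by apply: eq_bigr => x _; rewrite /g; ring.
  rewrite big_split sumrB /= -mulr_sumr sumr_const -(mulr_natr (mu ^+ 2)).
  have -> : \sum_x f x = mu * #|T|%:R by rewrite mulfVK.
  by ring.
by rewrite gerBl mulr_ge0 ?ler0n ?sqr_ge0.
Qed.

End Mean.

(** * Randomly pivoted Cholesky and the Nystrom approximation *)

Section Cholesky.
Variable R : realType.

Definition contractive_diag n (E : 'M[R]_n) := psd E /\ forall j, E j j <= 1.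

Lemma contractive_diag_pivot n (E : 'M[R]_n) i :
  contractive_diag E -> contractive_diag (pivot E i).
Proof.
move=> [pE E1]; split=> [|j]; first exact: pivot_psd.
by apply: le_trans (E1 j); apply: pivot_diag_le.
Qed.

(** The value is the residual after the pivots in [s], not a triangular factor. *)
Definition cholesky n (E : 'M[R]_n) (s : seq 'I_n) := foldl (@pivot R n) E s.

Lemma contractive_diag_cholesky n (E : 'M[R]_n) s :
  contractive_diag E -> contractive_diag (cholesky E s).
Proof. by elim: s E => //= i s IHs E /(contractive_diag_pivot i)/IHs. Qed.

Definition moment n (E : 'M[R]_n) p k := mean k (fun s => \tr (cholesky E s ^+ p.+1)).

Lemma moment_ge0 n (E : 'M[R]_n) p k : contractive_diag E -> 0 <= moment E p k.
Proof.
move=> cE; apply: mean_ge0 => s; apply: psd_trace_ge0; apply: psd_exp.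
by case: (contractive_diag_cholesky s cE).
Qed.

(** At [k = 0] this is [pivot_trace] averaged over the pivot, the diagonal entries summing to a
    trace. Conditioning on the first pivot gives the rest. *)
Lemma moment_decrease n (E : 'M[R]_n.+1) p k : contractive_diag E ->
  moment E p k.+1 + moment E p.+1 k / n.+1%:R <= moment E p k.
Proof.
have n0 : (0 < #|'I_n.+1|)%N by rewrite card_ord.
have n0' : 0 < n.+1%:R :> R by rewrite ltr0n.
elim: k E => [|k IHk] E cE.
  rewrite /moment meanS !mean0 card_ord.
  rewrite -mulrDl ler_pdivrMr // -lerBrDr.
  apply: (@le_trans _ _ (\sum_i (\tr (E ^+ p.+1) - (E ^+ p.+2) i i))).
    apply: ler_sum => i _; rewrite mean0 /=; apply: pivot_trace; [exact: cE.1|exact: cE.2].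
  by rewrite sumrB sumr_const card_ord /= mulr_natr lexx.
have momS q l : moment E q l.+1 = (\sum_i moment (pivot E i) q l) / n.+1%:R.
  by rewrite /moment meanS card_ord.
rewrite !momS mulrAC -mulrDl ler_wpM2r ?invr_ge0 ?ler0n //.
rewrite mulr_suml -big_split /=; apply: ler_sum => i _.
exact/IHk/contractive_diag_pivot.
Qed.

(** Telescoping over [K] steps bounds the sum of [a p.+1] there by [a p] at the start. As [a p.+1]
    does not increase in time, [K] times its final value obeys the same bound: each order gains a
    factor [K]. *)
Lemma cascade_bound (a : nat -> nat -> R) K :
  (forall p k, 0 <= a p k) -> (forall p k, a p k.+1 + a p.+1 k <= a p k) ->
  a 0 0 <= 1 -> forall p, a p (p * K)%N * K%:R ^+ p <= 1.
Proof.
move=> a0 aS a1; elim=> [|p IHp]; first by rewrite expr0 mulr1.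
have amono q k j : a q (k + j)%N <= a q k.
  elim: j => [|j IHj]; first by rewrite addn0.
  by apply: le_trans IHj; rewrite addnS; have := aS q (k + j)%N; have := a0 q.+1 (k + j)%N; lra.
have asum k j : a p (k + j)%N + \sum_(i < j) a p.+1 (k + i)%N <= a p k.
  elim: j => [|j IHj]; first by rewrite big_ord0 addn0 addr0.
  by rewrite big_ord_recr /= addnS; have := aS p (k + j)%N; lra.
have h : a p.+1 (p.+1 * K)%N * K%:R <= a p (p * K)%N.
  apply: le_trans (asum (p * K)%N K); rewrite mulSn addnC.
  apply: (@le_trans _ _ (\sum_(i < K) a p.+1 (p * K + i)%N)); last by rewrite lerDr.
  rewrite mulr_natr -{3}(card_ord K) -sumr_const; apply: ler_sum => i _.
  by have := amono p.+1 (p * K + i)%N (K - i)%N; rewrite -addnA subnKC // ltnW.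
by apply: le_trans IHp; rewrite exprS mulrA ler_wpM2r ?exprn_ge0 ?ler0n.
Qed.

Lemma moment_bound n (E : 'M[R]_n.+1) p K : contractive_diag E ->
  moment E p (p * K) * K%:R ^+ p <= n.+1%:R ^+ p.+1.
Proof.
(* This scaling absorbs the factor [1/n] of the recursion and brings the initial trace, at most the
   dimension, below 1. *)
move=> cE; pose a p k := moment E p k / n.+1%:R ^+ p.+1.
have n0' : 0 < n.+1%:R :> R by rewrite ltr0n.
have n0 : (0 < #|'I_n.+1|)%N by rewrite card_ord.
suff: a p (p * K)%N * K%:R ^+ p <= 1 by rewrite /a mulrAC ler_pdivrMr ?exprn_gt0 // mul1r.
apply: cascade_bound => [q k|q k|]; rewrite /a.
- by rewrite mulr_ge0 ?moment_ge0 // invr_ge0 exprn_ge0 // ltW.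
- rewrite (exprSr _ q.+1) invfM (mulrC (_ ^- _)) (mulrA (moment E q.+1 k)) -mulrDl.
  by rewrite ler_wpM2r ?invr_ge0 ?exprn_ge0 ?ler0n // moment_decrease.
- rewrite /moment mean0 !expr1 ler_pdivrMr // mul1r.
  apply: (@le_trans _ _ (\sum_(i < n.+1) 1)).
    by apply: ler_sum => i _; exact: cE.2.
  by rewrite sumr_const card_ord.
Qed.

(** One eigenvalue above [t] would alone push the trace beyond [t^(p+1)]. *)
Lemma trace_exp_qform n (E : 'M[R]_n) p t : psd E -> 0 <= t ->
  \tr (E ^+ p.+1) <= t ^+ p.+1 ->
  forall x : 'rV_n, (x *m E *m x^T) 0 0 <= t * (x *m x^T) 0 0.
Proof.
move=> /psd_eigendec[P [d [dE d0]]] t0 trE x; apply: (eig_support_le dE) => j tj.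
have := le_lt_trans trE (_ : t ^+ p.+1 < d 0 j ^+ p.+1).
rewrite ltrXn2r // => /(_ isT); rewrite (eigendec_trace (eigendec_exp p.+1 dE)).
rewrite (bigD1 j) //= mxE ltNge lerDl sumr_ge0 // => i _.
by rewrite mxE exprn_ge0.
Qed.

(* Only the columns of [X] listed in [s] are read; see [eq_nystrom]. *)
Definition nystrom n (X : 'M[R]_n) (s : seq 'I_n) :=
  foldl (fun N i => N + ((X - N) i i)^-1 *: (col i (X - N) *m (col i (X - N))^T)) 0 s.

Lemma nystrom_cholesky n (X : 'M[R]_n) s : X - nystrom X s = cholesky X s.
Proof.
rewrite /nystrom /cholesky; set f := fun N i => _.
suff gen N : X - foldl f N s = foldl (@pivot R n) (X - N) s by rewrite gen subr0.
by elim: s N => //= i s IHs N; rewrite IHs /f /pivot opprD addrA.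
Qed.

(** The pivot entry lies in the pivot column. This allows a run on a matrix whose unread entries are
    zero. *)
Lemma eq_nystrom n (X Y : 'M[R]_n) s : {in s, forall i, col i X = col i Y} ->
  nystrom X s = nystrom Y s.
Proof.
rewrite /nystrom; elim: s 0 => //= i s IHs N XY.
have eqi : col i (X - N) = col i (Y - N) by rewrite !linearB /= XY ?mem_head.
have -> : (X - N) i i = (Y - N) i i.
  by have /colP/(_ i) := eqi; rewrite mxE [RHS]mxE.
by rewrite eqi; apply: IHs => j js; apply: XY; rewrite inE js orbT.
Qed.

End Cholesky.

(** * Comparison of sorted spectra *)

Section Lists.
Variable R : realType.

(** [sym_spectral] only asserts existence, so the decomposition is chosen classically; the query
    model charges for reading entries alone. *)
Definition eigs n (A : 'M[R]_n) : seq R :=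
  if pselect (A^T = A) is left symA then
    sort (fun x y => y <= x) [seq sval (cid (svalP (cid (sym_spectral symA)))) 0 j | j <- enum 'I_n]
  else [::].

Lemma eigsP n (A : 'M[R]_n) : A^T = A -> exists P d,
  eigendec A P d /\ eigs A = sort (fun x y => y <= x) [seq d 0 j | j <- enum 'I_n].
Proof.
rewrite /eigs; case: pselect => // symA _.
by case: cid => P /= dP; case: cid => d /= dA; exists P, d.
Qed.

Lemma eigs_spectrum n (A : 'M[R]_n) : A^T = A -> is_spectrum A (eigs A).
Proof.
move=> /eigsP[P [d [dA ->]]]; split.
- by rewrite size_sort size_map size_enum_ord.
- by apply: sort_sorted => x y; exact: le_total.
- rewrite (char_poly_eigendec dA) (perm_big _ (permEl (perm_sort _ _))) /=.
  by rewrite big_map big_enum.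
Qed.

Lemma eigs_ge0 n (A : 'M[R]_n) i : psd A -> 0 <= nth 0 (eigs A) i.
Proof.
move=> pA; have [P [d [dA ->]]] := eigsP pA.1.
set l := sort _ _; case: (ltnP i (size l)) => il; last by rewrite nth_default.
have := mem_nth 0 il; rewrite mem_sort => /mapP[j _ ->].
by rewrite -(eigendec_eigenvector j dA) psd_row.
Qed.

(** With [0 <= t], the default 0 beyond the end of the list never exceeds [t]. *)
Lemma nth_gt_count (s : seq R) i t : sorted (fun x y => y <= x) s -> 0 <= t ->
  (t < nth 0 s i) = (i < count (fun x => t < x)%R s)%N.
Proof.
move=> + t0; elim: s i => [|x s IHs] i /=; first by rewrite nth_nil ltNge t0.
move=> xs; have xall : all (fun y => y <= x) s.
  by apply: order_path_min xs => a b c ba cb; exact: le_trans cb ba.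
case: (ltP t x) => tx.
  by case: i => [|i] /=; rewrite ?tx // IHs ?(path_sorted xs).
have /eqP -> : count (fun y => t < y)%R s == 0%N.
  rewrite -leqn0 leqNgt -has_count -all_predC; apply: sub_all xall => y yx /=.
  by rewrite -leNgt (le_trans yx).
rewrite addn0 ltn0; apply/negbTE; rewrite -leNgt; case: i => [|i] //=.
case: (ltnP i (size s)) => il; last by rewrite nth_default.
by apply: le_trans tx; apply: (allP xall); apply: mem_nth.
Qed.

Lemma nth_sort_gt n (d : 'rV[R]_n) k i t : 0 < k -> 0 <= t ->
  (t < k * nth 0 (sort (fun x y => y <= x) [seq d 0 j | j <- enum 'I_n]) i) =
  (i < #|[pred j | (t < (k *: d) 0 j)%R]|)%N.
Proof.
move=> k0 t0; rewrite -ltr_pdivrMl // nth_gt_count; first last.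
- by rewrite mulr_ge0 // invr_ge0 ltW.
- by apply: sort_sorted => x y; exact: le_total.
rewrite (permP (permEl (perm_sort _ _))) count_map -sum1_count big_enum_cond /= -sum1_card.
congr (_ < _)%N; apply: eq_bigl => j.
by rewrite !inE mxE ltr_pdivrMl.
Qed.

(** Turns counts at all thresholds into a bound at each rank, by taking [t] to be the scaled [i]-th
    eigenvalue of [A']. The sizes may differ, missing eigenvalues reading as 0. *)
Lemma eigs_count_le n m (A : 'M[R]_n) (A' : 'M[R]_m) k k' e i :
  A^T = A -> psd A' -> 0 < k -> 0 < k' -> 0 <= e ->
  (forall P d P' d' t, 0 <= t -> eigendec (k *: A) P d -> eigendec (k' *: A') P' d' ->
    (#|[pred j | (t + e < d 0 j)%R]| <= #|[pred j | (t < d' 0 j)%R]|)%N) ->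
  k * nth 0 (eigs A) i <= k' * nth 0 (eigs A') i + e.
Proof.
move=> symA pA' k0 k0' e0 H; have t0 := eigs_ge0 i pA'.
have [P [d [dA lA]]] := eigsP symA; have [P' [d' [dA' lA']]] := eigsP pA'.1.
have t0' : 0 <= k' * nth 0 (eigs A') i by rewrite mulr_ge0 // ltW.
have := H _ _ _ _ _ t0' (eigendecZ k dA) (eigendecZ k' dA').
move=> le_card; rewrite leNgt; apply/negP.
rewrite {1}lA (nth_sort_gt d _ k0) ?addr_ge0 // => /leq_trans/(_ le_card).
by rewrite -(nth_sort_gt d' _ k0') // -lA' ltxx.
Qed.

End Lists.

(** * Spectra of random principal submatrices *)

Section Sampling.
Variable R : realType.

Definition frob2 n (D : 'M[R]_n) := \sum_k \sum_l D k l ^+ 2.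

(** Cauchy-Schwarz is applied once to [x D] and [x], then once to each column of [D]. *)
Lemma qform_frob n (D : 'M[R]_n) (x : 'rV_n) t : 0 <= t -> frob2 D <= t ^+ 2 ->
  `|(x *m D *m x^T) 0 0| <= t * (x *m x^T) 0 0.
Proof.
move=> t0 Dt; have x0 := dot_ge0 x.
rewrite -(@ler_pXn2r _ 2) ?nnegrE ?mulr_ge0 // -normrX ger0_norm ?sqr_ge0 // exprMn.
apply: le_trans (cauchy_schwarz _ _) _.
rewrite expr2 mulrA ler_wpM2r //; apply: (@le_trans _ _ (frob2 D * (x *m x^T) 0 0)); last first.
  by rewrite ler_wpM2r.
rewrite /frob2 exchange_big /= mulr_suml [leLHS]mxE; apply: ler_sum => l _.
rewrite [X in _ * X]mxE -expr2.
have -> : (x *m D) 0 l = (x *m (row l D^T)^T) 0 0.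
  by rewrite tr_row trmxK !mxE; apply: eq_bigr => k _; rewrite !mxE.
apply: le_trans (cauchy_schwarz _ _) _; rewrite mulrC ler_wpM2r //.
rewrite mxE; apply: ler_sum => k _.
by rewrite !mxE -expr2.
Qed.

(** Empirical second moment of the columns of [B] minus its expectation [B B^T / n]; [m] stands for
    the length of [s]. *)
Definition sample_gap n (B : 'M[R]_n) m (s : seq 'I_n) : 'M[R]_n :=
  \matrix_(k, l) ((\sum_(t <- s) B k t * B l t) / m%:R - (\sum_t B k t * B l t) / n%:R).

(** Entrywise variances add up to a bound free of the dimension: summing [(B k t * B l t)^2] over
    [k] and [l] gives the square of [(B^T B)_tt], at most 1. *)
Lemma mean_sample_gap n (B : 'M[R]_n.+1) m : (0 < m)%N -> 
  (forall i, `|(B^T *m B) i i| <= 1) ->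
  mean m (fun s => frob2 (sample_gap B m s)) <= m%:R^-1.
Proof.
move=> m0 B1; have n0 : (0 < #|'I_n.+1|)%N by rewrite card_ord.
rewrite /frob2 mean_sum; under eq_bigr do rewrite mean_sum.
apply: (@le_trans _ _ (\sum_k \sum_l (\sum_t (B k t * B l t) ^+ 2) / n.+1%:R / m%:R)).
  apply: ler_sum => k _; apply: ler_sum => l _.
  have := mean_variance n0 (fun t => B k t * B l t) m0; rewrite card_ord.
  by apply: le_trans; apply: ler_mean => s; rewrite mxE.
have -> : \sum_k \sum_l (\sum_t (B k t * B l t) ^+ 2) / n.+1%:R / m%:R =
    (\sum_t ((B^T *m B) t t) ^+ 2) / n.+1%:R / m%:R.
  pose F k l t := (B k t * B l t) ^+ 2 / n.+1%:R / m%:R.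
  transitivity (\sum_k \sum_l \sum_t F k l t).
    by apply: eq_bigr => k _; apply: eq_bigr => l _; rewrite !mulr_suml.
  transitivity (\sum_k \sum_t \sum_l F k l t).
    by apply: eq_bigr => k _; rewrite exchange_big.
  rewrite exchange_big /= !mulr_suml; apply: eq_bigr => t _.
  rewrite mxE expr2 big_distrlr /= !mulr_suml; apply: eq_bigr => k _.
  by rewrite !mulr_suml; apply: eq_bigr => l _; rewrite /F !mxE; congr (_ / _ / _); ring.
rewrite ler_piMl ?invr_ge0 ?ler0n // ler_pdivrMr ?ltr0n // mul1r.
apply: (@le_trans _ _ (\sum_(t < n.+1) 1)); last by rewrite sumr_const card_ord.
by apply: ler_sum => t _; rewrite -real_normK ?num_real // exprn_ile1.
Qed.

(** Sampling is with replacement, so rows and columns may repeat. *)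
Definition principal n m (A : 'M[R]_n) (T : m.-tuple 'I_n) : 'M[R]_m :=
  \matrix_(a, b) A (tnth T a) (tnth T b).

Lemma principal_psd n m (A : 'M[R]_n) (T : m.-tuple 'I_n) : psd A -> psd (principal A T).
Proof.
move=> /psd_sqrt[B [symB AE]].
have -> : principal A T = rowsub (tnth T) B *m (rowsub (tnth T) B)^T.
  apply/matrixP => a b; rewrite mxE AE -{2}symB [LHS]mxE [RHS]mxE.
  by apply: eq_bigr => k _; rewrite !mxE.
exact: gram_psd.
Qed.

(** For [C] the sampled columns of [B] over the square root of the sample size, [C^T C] is the
    normalized submatrix and [C C^T] differs from the normalized [A] by the sample gap. The two
    counting lemmas give the two inequalities. *)
Lemma principal_approx n m (A B : 'M[R]_n.+1) (T : m.+1.-tuple 'I_n.+1) e i :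
  psd A -> B^T = B -> A = B *m B -> 0 <= e -> frob2 (sample_gap B m.+1 T) <= e ^+ 2 ->
  `|m.+1%:R^-1 * nth 0 (eigs (principal A T)) i - n.+1%:R^-1 * nth 0 (eigs A) i| <= e.
Proof.
move=> pA symB AE e0 gap.
have m0 : 0 < m.+1%:R :> R by rewrite ltr0n.
have m0' : 0 < m.+1%:R^-1 :> R by rewrite invr_gt0.
have n0' : 0 < n.+1%:R^-1 :> R by rewrite invr_gt0 ltr0n.
pose C : 'M_(n.+1, m.+1) := (Num.sqrt m.+1%:R)^-1 *: colsub (tnth T) B.
have CT : C^T = (Num.sqrt m.+1%:R)^-1 *: (colsub (tnth T) B)^T.
  by apply/matrixP => a b; rewrite !mxE.
have CC : m.+1%:R^-1 *: principal A T = C^T *m C.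
  rewrite CT /C -scalemxAl -scalemxAr scalerA -expr2 exprVn sqr_sqrtr ?ltW //.
  congr (_ *: _); apply/matrixP => a b; rewrite !mxE AE -{1}symB mxE.
  by apply: eq_bigr => k _; rewrite !mxE.
have gapE : sample_gap B m.+1 T = C *m C^T - n.+1%:R^-1 *: A.
  rewrite CT /C -scalemxAl -scalemxAr scalerA -expr2 exprVn sqr_sqrtr ?ltW //.
  apply/matrixP => k l; rewrite !mxE mulrC; congr (_ * _ - _).
    by rewrite big_tuple; apply: eq_bigr => a _; rewrite !mxE.
  rewrite mulrC AE -{2}symB mxE; congr (_ * _).
  by apply: eq_bigr => t _; rewrite !mxE.
have psdS := principal_psd T pA.
have qgap (x : 'rV_n.+1) : `|(x *m (C *m C^T) *m x^T) 0 0 - (x *m (n.+1%:R^-1 *: A) *m x^T) 0 0|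
    <= e * (x *m x^T) 0 0.
  have := qform_frob x e0 gap; rewrite gapE mulmxBr mulmxBl.
  by rewrite mxE [X in _ + X]mxE.
have h1 : n.+1%:R^-1 * nth 0 (eigs A) i <= m.+1%:R^-1 * nth 0 (eigs (principal A T)) i + e.
  apply: eigs_count_le => //; first exact: pA.1.
  move=> P d P' d' t t0 dA dS; apply: (sample_count_le t0 dA dS CC) => x.
  by have := qgap x; rewrite ler_norml => /andP[]; lra.
have h2 : m.+1%:R^-1 * nth 0 (eigs (principal A T)) i <= n.+1%:R^-1 * nth 0 (eigs A) i + e.
  apply: eigs_count_le => //; first exact: psdS.1.
  move=> P d P' d' t t0 dS dA; apply: (sample_count_ge t0 e0 dA dS CC) => x.
  by have := qgap x; rewrite ler_norml => /andP[]; lra.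
by rewrite ler_distl lerBlDr h1 h2.
Qed.

(** * Spectral error of the Nystrom approximation *)

Lemma psdD n (A B : 'M[R]_n) : psd A -> psd B -> psd (A + B).
Proof.
move=> [symA A0] [symB B0]; split=> [|x].
  by rewrite /symmetric_mx linearD /= symA symB.
by rewrite mulmxDr mulmxDl mxE addr_ge0.
Qed.

Lemma psdZ n (A : 'M[R]_n) k : 0 <= k -> psd A -> psd (k *: A).
Proof.
move=> k0 [symA A0]; split=> [|x]; first by rewrite /symmetric_mx linearZ /= symA.
by rewrite -scalemxAr -scalemxAl mxE mulr_ge0.
Qed.

Lemma nystrom_psd n (X : 'M[R]_n) s : psd X -> psd (nystrom X s).
Proof.
rewrite /nystrom => pX; have : psd (X - 0) by rewrite subr0.
have : psd (0 : 'M[R]_n).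
  by split=> [|x]; rewrite /symmetric_mx ?trmx0 // mulmx0 mul0mx mxE.
elim: s (0 : 'M_n) => //= i s IHs N pN pXN; apply: IHs.
  by apply: psdD => //; apply: psdZ (gram_psd _); rewrite invr_ge0 psd_diag_ge0.
by have := pivot_psd i pXN; rewrite /pivot opprD addrA.
Qed.

(** The residual is positive semidefinite and at most [e * n.+1%:R] times the identity, so Weyl's
    inequality applies both ways. *)
Lemma nystrom_approx n (X : 'M[R]_n.+1) s e i : psd X -> 0 <= e ->
  (forall x : 'rV_n.+1, (x *m cholesky X s *m x^T) 0 0 <= (e * n.+1%:R) * (x *m x^T) 0 0) ->
  psd (cholesky X s) ->
  `|n.+1%:R^-1 * nth 0 (eigs (nystrom X s)) i - n.+1%:R^-1 * nth 0 (eigs X) i| <= e.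
Proof.
move=> pX e0 le_e pE; have pN := nystrom_psd s pX.
have n0 : 0 < n.+1%:R^-1 :> R by rewrite invr_gt0 ltr0n.
have XE (x : 'rV_n.+1) : (x *m (n.+1%:R^-1 *: X) *m x^T) 0 0 =
    (x *m (n.+1%:R^-1 *: nystrom X s) *m x^T) 0 0 + n.+1%:R^-1 * (x *m cholesky X s *m x^T) 0 0.
  rewrite -nystrom_cholesky -!scalemxAr -!scalemxAl mulmxBr mulmxBl.
  by move: (x *m X *m x^T) (x *m nystrom X s *m x^T) => M N; rewrite !mxE; ring.
have h0 (x : 'rV_n.+1) : 0 <= n.+1%:R^-1 * (x *m cholesky X s *m x^T) 0 0.
  by rewrite mulr_ge0 ?psd_row // ltW.
have h1 (x : 'rV_n.+1) : n.+1%:R^-1 * (x *m cholesky X s *m x^T) 0 0 <= e * (x *m x^T) 0 0.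
  by rewrite ler_pdivrMl ?ltr0n // mulrA (mulrC _ e).
have c1 : n.+1%:R^-1 * nth 0 (eigs (nystrom X s)) i <= n.+1%:R^-1 * nth 0 (eigs X) i + e.
  apply: eigs_count_le => //; first exact: pN.1.
  move=> P d P' d' t t0 dN dX; apply: (weyl_count _ dX dN) => x.
  by rewrite XE -addrA lerDl addr_ge0 // mulr_ge0 // dot_ge0.
have c2 : n.+1%:R^-1 * nth 0 (eigs X) i <= n.+1%:R^-1 * nth 0 (eigs (nystrom X s)) i + e.
  apply: eigs_count_le => //; first exact: pX.1.
  move=> P d P' d' t t0 dX dN; apply: (weyl_count _ dN dX) => x.
  by rewrite XE lerD2l.
move: c1 c2; move: (_ * nth 0 (eigs (nystrom X s)) i) (_ * nth 0 (eigs X) i) => a b.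
move=> c1 c2; apply/ler_normlP; split; lra.
Qed.

End Sampling.

(** * The algorithm *)

Section Algorithm.
Variable R : realType.

(** The queries are listed in advance in [l]; [X] accumulates the answers. *)
Fixpoint ask_entries n (l : seq ('I_n * 'I_n)) (g : 'M[R]_n -> seq R) (X : 'M[R]_n) : qtree R n :=
  if l is ij :: l' then
    Ask ij.1 ij.2 (fun a => ask_entries l' g
      (\matrix_(k, h) if (k, h) == ij then a else X k h))
  else Ret n (g X).

Lemma nqueries_ask_entries n l g (X A : 'M[R]_n) :
  nqueries (ask_entries l g X) A = size l.
Proof. by elim: l X => //= ij l IHl X; rewrite IHl. Qed.

Lemma qrun_ask_entries n l g (X A : 'M[R]_n) :
  qrun (ask_entries l g X) A = g (\matrix_(k, h) if (k, h) \in l then A k h else X k h).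
Proof.
elim: l X => [|[i j] l IHl] X /=; first by congr g; apply/matrixP => k h; rewrite mxE.
rewrite IHl; congr g; apply/matrixP => k h; rewrite !mxE inE orbC.
by case: ifP => //= _; case: eqP => // -[-> ->].
Qed.

(** The default of [nth] pads a short list with zeros; a list longer than [n] is truncated. *)
Definition scaled_padding (k : R) n (l : seq R) := mkseq (fun i => k * nth 0 l i) n.

Lemma scaled_padding_sorted k n (l : seq R) : 0 <= k ->
  (forall i, 0 <= nth 0 l i) -> sorted (fun x y => y <= x) l ->
  sorted (fun x y => y <= x) (scaled_padding k n l).
Proof.
move=> k0 l0 /(sortedP 0) sl; apply/(sortedP 0) => i; rewrite size_mkseq => ni.
rewrite !nth_mkseq // ?ler_wpM2l //; last exact: ltnW.
by case: (ltnP i.+1 (size l)) => [/sl//|li]; rewrite [leLHS]nth_default.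
Qed.

Definition nystrom_entries n m (T : m.-tuple 'I_n) (s : seq 'I_m) : seq ('I_n * 'I_n) :=
  [seq (tnth T a, tnth T b) | a <- enum 'I_m, b <- s].

Definition nystrom_spectrum n m (T : m.-tuple 'I_n) (s : seq 'I_m) (X : 'M[R]_n) : seq R :=
  scaled_padding (n%:R / m%:R) n (eigs (nystrom (principal X T) s)).

Definition nystrom_tree n m (T : m.-tuple 'I_n) (s : seq 'I_m) : qtree R n :=
  ask_entries (nystrom_entries T s) (nystrom_spectrum T s) 0.

Lemma nqueries_nystrom_tree n m (T : m.-tuple 'I_n) (s : seq 'I_m) A :
  nqueries (nystrom_tree T s) A = (m * size s)%N.
Proof. by rewrite nqueries_ask_entries size_allpairs size_enum_ord. Qed.

Lemma qrun_nystrom_tree n m (T : m.-tuple 'I_n) (s : seq 'I_m) A :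
  qrun (nystrom_tree T s) A = nystrom_spectrum T s A.
Proof.
rewrite qrun_ask_entries /nystrom_spectrum; congr (scaled_padding _ _ (eigs _)).
apply: eq_nystrom => b bs; apply/colP => a; rewrite !mxE.
by rewrite (_ : _ \in _) //; apply/allpairsP; exists (a, b); rewrite mem_enum.
Qed.

(** The deterministic part: sampling and Nystrom approximation each contribute a normalized error
    [e]. *)
Lemma nystrom_spectrum_approx n m (A B : 'M[R]_n.+1) (T : m.+1.-tuple 'I_n.+1)
    (s : seq 'I_m.+1) e p :
  psd A -> (forall i j, `|A i j| <= 1) -> B^T = B -> A = B *m B -> 0 <= e ->
  frob2 (sample_gap B m.+1 T) <= e ^+ 2 ->
  \tr (cholesky (principal A T) s ^+ p.+1) <= (e * m.+1%:R) ^+ p.+1 ->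
  spectrum_approx A (2 * e * n.+1%:R) (nystrom_spectrum T s A).
Proof.
move=> pA A1 symB AE e0 gap trE; set X := principal A T.
have pX : psd X by exact: principal_psd.
have cX : contractive_diag X.
  by split=> [//|j]; rewrite mxE (le_trans (ler_norm _)).
have pE : psd (cholesky X s) by case: (contractive_diag_cholesky s cX).
have n0 : 0 < n.+1%:R :> R by rewrite ltr0n.
have pN := nystrom_psd s pX; have [_ sN _] := eigs_spectrum pN.1.
split.
- by rewrite size_mkseq.
- by apply: scaled_padding_sorted => // [|i]; [rewrite divr_ge0 ?ler0n|exact: eigs_ge0].
exists (eigs A); split; first exact: eigs_spectrum pA.1.
move=> i; rewrite nth_mkseq ?ltn_ord //.
have em0 : 0 <= e * m.+1%:R by rewrite mulr_ge0 // ler0n.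
have h1 := principal_approx i pA symB AE e0 gap.
have h2 := nystrom_approx i pX e0 (trace_exp_qform pE em0 trE) pE.
have := le_trans (ler_distD _ _ _) (lerD h2 h1).
rewrite -/X -(ler_pM2l n0) -{1}(gtr0_norm n0) -normrM mulrBr !mulrA mulfV ?gt_eqF // mul1r.
by rewrite (_ : n.+1%:R * (e + e) = 2 * e * n.+1%:R) //; ring.
Qed.

Definition uniform_weight (S : finType) (_ : S) : R := #|S|%:R^-1.

Lemma uniform_weight_ge0 (S : finType) (x : S) : 0 <= uniform_weight x.
Proof. by rewrite invr_ge0 ler0n. Qed.

Lemma uniform_weight_sum1 (S : finType) : (0 < #|S|)%N ->
  \sum_(x : S) uniform_weight x = 1.
Proof.
move=> S0; rewrite sumr_const -(mulr_natr #|S|%:R^-1) mulVf //.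
by rewrite pnatr_eq0 -lt0n.
Qed.

Definition nystrom_seed n m k : finType := (m.+1.-tuple 'I_n.+1 * k.-tuple 'I_m.+1)%type.

Lemma nystrom_seed_gt0 n m k : (0 < #|nystrom_seed n m k|)%N.
Proof. by rewrite card_prod !card_tuple !card_ord muln_gt0 !expn_gt0. Qed.

Definition nystrom_alg n m k : rand_qalg R n.+1 :=
  RandQAlg (@uniform_weight_ge0 (nystrom_seed n m k))
    (uniform_weight_sum1 (nystrom_seed_gt0 n m k))
    (fun q => nystrom_tree q.1 q.2).

Definition trivial_alg n : rand_qalg R n :=
  RandQAlg (@uniform_weight_ge0 unit) (uniform_weight_sum1 (S := unit) ltac:(by rewrite card_unit))
    (fun _ => Ret n [::]).

(** Each of the two bad events has probability at most 1/6 by Markov's inequality, which explains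
    both constants 6. *)
Lemma nystrom_alg_success n m K p (A : 'M[R]_n.+1) e :
  psd A -> (forall i j, `|A i j| <= 1) -> 0 < e ->
  6 <= m.+1%:R * e ^+ 2 -> 6 <= K%:R ^+ p * e ^+ p.+1 ->
  2 / 3 <= success_prob (nystrom_alg n m (p * K)) A (spectrum_approx A (2 * e * n.+1%:R)).
Proof.
move=> pA A1 e0 me Ke; have [B [symB AE]] := psd_sqrt pA.
pose G1 (T : seq 'I_n.+1) := frob2 (sample_gap B m.+1 T) / e ^+ 2.
pose G2 (T : m.+1.-tuple 'I_n.+1) (s : seq 'I_m.+1) :=
  \tr (cholesky (principal A T) s ^+ p.+1) / (e * m.+1%:R) ^+ p.+1.
pose S := nystrom_seed n m (p * K); pose w : R := #|S|%:R^-1.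
pose good (q : S) := `[< spectrum_approx A (2 * e * n.+1%:R) (qrun (nystrom_tree q.1 q.2) A) >].
have em0 : 0 < (e * m.+1%:R) ^+ p.+1 by rewrite exprn_gt0 // mulr_gt0 ?ltr0n.
have cT (T : m.+1.-tuple 'I_n.+1) : contractive_diag (principal A T).
  split=> [|j]; first exact: principal_psd.
  by rewrite mxE (le_trans (ler_norm _)).
have G1_ge0 T : 0 <= G1 T.
  rewrite mulr_ge0 ?invr_ge0 ?sqr_ge0 // !sumr_ge0 // => k _.
  by rewrite sumr_ge0 // => l _; rewrite sqr_ge0.
have G2_ge0 T s : 0 <= G2 T s.
  rewrite mulr_ge0 // ?invr_ge0 ?(ltW em0) //; apply: psd_trace_ge0; apply: psd_exp.
  by case: (contractive_diag_cholesky s (cT T)).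
(* Markov's inequality and the union bound in pointwise form: a bad seed has [G1 >= 1] or
   [G2 >= 1]. *)
have pointwise (q : S) : 1 <= (good q)%:R + G1 q.1 + G2 q.1 q.2.
  case: (boolP (good q)) => [_|bad]; first by rewrite -addrA lerDl addr_ge0.
  rewrite add0r leNgt; apply/negP => lt1; move/negP: bad; apply.
  have g1 : G1 q.1 < 1 by apply: le_lt_trans lt1; rewrite lerDl.
  have g2 : G2 q.1 q.2 < 1 by apply: le_lt_trans lt1; rewrite lerDr.
  apply/asboolP; rewrite qrun_nystrom_tree.
  apply: (nystrom_spectrum_approx pA A1 symB AE (ltW e0) (p := p)).
    by move: g1; rewrite ltr_pdivrMr ?exprn_gt0 // mul1r => /ltW.
  by move: g2; rewrite ltr_pdivrMr // mul1r => /ltW.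
have wE (F : m.+1.-tuple 'I_n.+1 -> (p * K).-tuple 'I_m.+1 -> R) :
    \sum_(q : S) w * F q.1 q.2 =
    (\sum_T (\sum_s F T s) / (m.+1 ^ (p * K))%:R) / (n.+1 ^ m.+1)%:R.
  rewrite -mulr_sumr -(pair_bigA _ F) /= -mulr_suml mulrC -mulrA; congr (_ * _).
  by rewrite /w card_prod !card_tuple !card_ord natrM invfM mulrC.
have wG1 : \sum_(q : S) w * G1 q.1 <= 6^-1.
  rewrite (wE (fun T _ => G1 T)).
  have cnt0 : (m.+1 ^ (p * K))%:R != 0 :> R by rewrite pnatr_eq0 -lt0n expn_gt0.
  under eq_bigr do rewrite sumr_const card_tuple card_ord -(mulr_natr (G1 _)) mulfK //.
  have -> : (\sum_(T : m.+1.-tuple 'I_n.+1) G1 T) / (n.+1 ^ m.+1)%:R =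
      mean m.+1 (fun T => e ^- 2 * frob2 (sample_gap B m.+1 T)).
    by rewrite /mean card_ord; congr (_ / _); apply: eq_bigr => T _; rewrite mulrC.
  rewrite meanZ; apply: (@le_trans _ _ (e ^- 2 * m.+1%:R^-1)).
    rewrite ler_wpM2l ?invr_ge0 ?sqr_ge0 // mean_sample_gap // => i.
    by rewrite symB -AE.
  by rewrite -invfM lef_pV2 ?posrE ?mulr_gt0 ?exprn_gt0 ?ltr0n // mulrC.
(* The moment bound holds for every fixed sample [T], so only the pivots need averaging. *)
have wG2 : \sum_(q : S) w * G2 q.1 q.2 <= 6^-1.
  rewrite (wE (fun T s => G2 T s)).
  have N0 : 0 < (n.+1 ^ m.+1)%:R :> R by rewrite ltr0n expn_gt0.
  rewrite ler_pdivrMr //; apply: (@le_trans _ _ (\sum_(T : m.+1.-tuple 'I_n.+1) 6^-1)).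
    apply: ler_sum => T _.
    have -> : (\sum_(s : (p * K).-tuple 'I_m.+1) G2 T s) / (m.+1 ^ (p * K))%:R =
        moment (principal A T) p (p * K) / (e * m.+1%:R) ^+ p.+1.
      by rewrite /moment /mean card_ord -mulr_suml mulrAC.
    have := moment_bound p K (cT T); set M := moment _ _ _ => MK.
    have KK0 : 0 < K%:R ^+ p :> R.
      have : 0 < K%:R ^+ p * e ^+ p.+1 by apply: lt_le_trans Ke.
      by rewrite pmulr_lgt0 // exprn_gt0.
    rewrite ler_pdivrMr // -(ler_pM2r KK0); apply: le_trans MK _.
    rewrite exprMn -mulrA mulrAC (mulrC _ (K%:R ^+ p)) mulrA.
    rewrite ler_peMl ?exprn_ge0 ?ler0n //.
    by rewrite ler_pdivlMl // mulr1.
  by rewrite sumr_const card_tuple card_ord -(mulr_natr 6^-1).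
have w1 : \sum_(q : S) w = 1 by exact: uniform_weight_sum1 (nystrom_seed_gt0 n m _).
have : \sum_(q : S) w <= \sum_(q : S) w * ((good q)%:R + G1 q.1 + G2 q.1 q.2).
  apply: ler_sum => q _; rewrite ler_peMr // invr_ge0 ler0n //.
rewrite w1; under eq_bigr do rewrite !mulrDr.
rewrite !big_split /= => le1.
have -> : success_prob (nystrom_alg n m (p * K)) A (spectrum_approx A (2 * e * n.+1%:R)) =
    \sum_(q : S) w * (good q)%:R.
  rewrite /success_prob big_mkcond /=; apply: eq_bigr => q _.
  by rewrite /good; case: ifP; rewrite ?mulr1 ?mulr0.
lra.
Qed.

End Algorithm.

(** * Choice of parameters and query count *)

Lemma ln_le_exp4 (R : realType) (x : R) q : 0 < x -> ln x <= q%:R -> x <= 4 ^+ q.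
Proof.
move=> x0 lq; rewrite -[x](@lnK R) ?posrE //.
apply: (@le_trans _ _ (sequences.expR q%:R)); first by rewrite ler_expR.
have -> : q%:R = q%:R * 2%:R * 2^-1 :> R by rewrite mulfK // pnatr_eq0.
rewrite -natrM expRM_natl mulnC exprM lerXn2r ?nnegrE ?exprn_ge0 ?expR_ge0 //.
(* From [expR x >= 1 + x] at [-1/2]; inverting and squaring gives the base 4. *)
have half : 2^-1 <= sequences.expR (- 2^-1 : R).
  by apply: le_trans (expR_ge1Dx _); lra.
have : sequences.expR (2^-1 : R) <= 2.
  by rewrite -[leLHS]invrK -expRN -[leRHS]invrK lef_pV2 ?posrE ?expR_gt0 // invr_gt0.
have -> : 4 = 2 ^+ 2 :> R by ring.
by move=> h; rewrite lerXn2r ?nnegrE ?expR_ge0.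
Qed.

(** For [e = eps / 2]: the sample size exceeds [24 / eps^2 = 6 / e^2], the factor [K > 8 / eps]
    gives [K e >= 4], and the three added to the logarithm give [4^p >= 16 eps^-3]. *)
Definition spectrum_alg (R : realType) (n : nat) (eps : R) : rand_qalg R n :=
  if n is n'.+1 then
    nystrom_alg R n' (Num.truncn (24 / eps ^+ 2))
      ((Num.truncn (ln (eps^-3))).+3 * (Num.truncn (8 / eps)).+1)
  else trivial_alg R 0.

(* Query bound ~O(1/eps^3) read as  C * f * (1 + ln f)^c  with f = 1/eps^3,
   uniformly in n. *)
Theorem mainTheorem6 (R : realType) :
  exists (c : nat) (C : R) (alg : forall (n : nat) (eps : R), rand_qalg R n),
    0 < C /\
    forall (n : nat) (eps : R) (A : 'M[R]_n),
      0 < eps < 1 ->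
      psd A ->
      (forall i j, `|A i j| <= 1) ->
      (forall s : seed (alg n eps),
          (nqueries (alg_of s) A)%:R
            <= C * eps^-3 * (1 + ln (eps^-3)) ^+ c) /\
      success_prob (alg n eps) A (spectrum_approx A (eps * n%:R))
        >= 2 / 3.
Proof.
(* [675 = 25 * 3 * 9] multiplies the constants bounding the sample size, [p] and [K]. *)
exists 1%N, 675, (@spectrum_alg R); split=> [|n eps A /andP[e0 e1] pA A1]; first by rewrite ltr0n.
set L := ln (eps^-3).
have i1 : 1 <= eps^-1 by rewrite invf_ge1 // ltW.
have eN : eps^-3 = eps^-1 ^+ 3 by rewrite exprVn.
have L0 : 0 <= L by rewrite ln_ge0 // eN exprn_ege1.
rewrite expr1; case: n A pA A1 => [|n] A pA A1.
  split=> [s|] /=; first by rewrite mulr_ge0 ?addr_ge0 // mulr_ge0 // eN exprn_ge0 // invr_ge0 ltW.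
  rewrite /success_prob big_mkcond /= (eq_bigr (fun _ => @uniform_weight R unit tt)) => [|s _].
    rewrite (@uniform_weight_sum1 R unit) ?card_unit //; lra.
  case: asboolP => // -[]; split=> //; exists (eigs A); split; last by case.
  exact: eigs_spectrum pA.1.
have t24 : 0 <= 24 / eps ^+ 2 by rewrite divr_ge0 ?exprn_ge0 // ltW.
have t8 : 0 <= 8 / eps by rewrite divr_ge0 // ltW.
split=> [s|].
  rewrite /= nqueries_nystrom_tree size_tuple !natrM.
  have := truncn_le (24 / eps ^+ 2); rewrite t24 => m24.
  have := truncn_le (8 / eps); rewrite t8 => k8.
  have := truncn_le L; rewrite L0 => pL.
  have a1 : (Num.truncn (24 / eps ^+ 2)).+1%:R <= 25 * eps^-1 ^+ 2 :> R.
    by have := exprn_ege1 2 i1; rewrite -natr1 exprVn; lra.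
  have a2 : (Num.truncn (8 / eps)).+1%:R <= 9 * eps^-1 :> R by rewrite -natr1; lra.
  have a3 : (Num.truncn L).+3%:R <= 3 * (1 + L).
    by rewrite -addn3 natrD; lra.
  apply: (@le_trans _ _ ((25 * eps^-1 ^+ 2) * ((3 * (1 + L)) * (9 * eps^-1)))).
    by rewrite ler_pM ?mulr_ge0 ?ler0n // ler_pM ?ler0n.
  rewrite eN le_eqVlt; apply/orP; left; apply/eqP; ring.
rewrite /spectrum_alg -/L; set m := Num.truncn _; set K := (Num.truncn (8 / eps)).+1.
set p := (Num.truncn L).+3; pose e := eps / 2.
have -> : eps * n.+1%:R = 2 * e * n.+1%:R by rewrite /e mulrCA mulfV ?mulr1 ?pnatr_eq0.
have he0 : 0 < e by rewrite divr_gt0.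
apply: nystrom_alg_success => //.
  have := ltW (truncnS_gt (24 / eps ^+ 2)); rewrite ler_pdivrMr ?exprn_gt0 // -/m => h.
  rewrite /e expr_div_n mulrA ler_pdivlMr ?exprn_gt0 //; move: h; set y := _ * _; lra.
have Ke : 4 <= K%:R * e.
  have := ltW (truncnS_gt (8 / eps)); rewrite ler_pdivrMr // -/K => h.
  rewrite /e mulrA ler_pdivlMr //; move: h; set y := _ * _; lra.
(* Now [K^p e^(p+1) >= 4^p e >= 16 eps^-1 (eps / 2) = 8], above the required 6. *)
rewrite exprSr mulrA -exprMn; apply: (@le_trans _ _ (4 ^+ p * e)); last first.
  by rewrite ler_wpM2r ?(ltW he0) // lerXn2r ?nnegrE // (le_trans _ Ke).
have : eps^-3 <= 4 ^+ (Num.truncn L).+1.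
  by apply: ln_le_exp4; [rewrite eN exprn_gt0 ?invr_gt0|exact: ltW (truncnS_gt L)].
rewrite /p [4 ^+ _.+3]exprS [4 ^+ _.+2]exprS; set x := 4 ^+ _ => ex.
have : eps^-1 <= x by apply: le_trans ex; rewrite eN ler_eXnr.
by rewrite -(ler_pM2r e0) mulVf ?gt_eqF // /e; lra.
Qed.
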